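(* Let $n\ge 1$ and $s\ge 1$ be integers and let $\Sigma_n$ be the symmetric group on $n$ letters. The number of commuting ordered $s$-tuples in $\Sigma_n$ is given by $$|\mathrm{Hom}(\mathbb{Z}^s,\Sigma_n)|=\sum_{1^{a_1}2^{a_2}\cdots n^{a_n}\in \mathcal{P}_n}\frac{n!}{\prod_{i=1}^{n} i^{a_i}a_i!}\prod_{i=1}^{n} j_i(\mathbb{Z}^s)^{a_i}.$$
   Context: $\mathcal{P}_n$ is the set of all partitions of $n$; the partition written $1^{a_1}2^{a_2}\cdots n^{a_n}$ has exactly $a_k\ge 0$ parts equal to $k$, so $\sum_{k=1}^n k a_k=n$. $j_r(\mathbb{Z}^s)$ is the (finite) number of subgroups of $\mathbb{Z}^s$ of index $r$. $\mathrm{Hom}(\mathbb{Z}^s,\Sigma_n)$ is identified with the set of ordered $s$-tuples of pairwise commuting elements of $\Sigma_n$. *)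

(* Defs.v *)
From mathcomp Require Import all_boot all_order all_algebra all_fingroup.
From mathcomp Require Import finmap.
From mathcomp Require Import boolp classical_sets functions cardinality.

Set Implicit Arguments.
Unset Strict Implicit.
Unset Printing Implicit Defensive.

Import GRing.Theory.

(* The partition 1^{a_1} ... n^{a_n} of n is encoded by its multiplicities:
   a i is the number of parts equal to i.+1.  The bound a i <= n carried by the
   codomain is no restriction, since it follows from the defining equation. *)
Definition partitions (n : nat) : {set {ffun 'I_n -> 'I_n.+1}} :=
  [set a : {ffun 'I_n -> 'I_n.+1} | \sum_(i < n) i.+1 * a i == n].

Definition commuting_tuples (s n : nat) : {set s.-tuple 'S_n} :=
  [set t : s.-tuple 'S_n |
    [forall i, forall j,
      (tnth t i * tnth t j == tnth t j * tnth t i)%g]].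

Local Open Scope classical_set_scope.
Local Open Scope ring_scope.

Definition subgroup (V : zmodType) (H : set V) : Prop :=
  zmod_closed [in H].

Definition cosets (V : zmodType) (H : set V) : set (set V) :=
  range (fun x : V => [set x + h | h in H]).

Definition has_index (V : zmodType) (H : set V) (r : nat) : Prop :=
  (cosets H #= `I_r)%card.

(* j_r(Z^s), with Z^s the row vectors 'rV[int]_s.  fset_set is the finite set
   underlying a set known to be finite (and empty by default otherwise); for
   r > 0 the set of subgroups of index r is finite, so this is its cardinal. *)
Definition subgroup_count (s r : nat) : nat :=
  #|` fset_set [set H : set 'rV[int]_s | subgroup H /\ has_index H r] |.

(* Main.v *)
Require Import Defs.
From mathcomp Require Import all_boot all_order all_algebra all_fingroup.
From mathcomp Require Import finmap ring zify.
From mathcomp Require Import boolp classical_sets cardinality.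

Import GRing.Theory Num.Theory.
Local Open Scope ring_scope.

Set Implicit Arguments.
Unset Strict Implicit.
Unset Printing Implicit Defensive.

(** Write [h_m] for the number of commuting [s]-tuples of permutations of an
    [m]-element set, i.e. of actions of Z^s on that set, and [j_r] for the number
    of subgroups of Z^s of index [r].  The two sides of the formula agree because
    both, once divided by [m!], solve the same recurrence
    [m p_m = \sum_(1 <= k <= m) j_k p_(m - k)] with [p_0 = 1].

    On the side of the actions, count the pairs (action on [S], point [x] of [S])
    according to the orbit [U] of [x].  An action on [S] for which [U] is the
    orbit of [x] is the same thing as a transitive action on [U] together with an
    arbitrary action on [S :\: U] ([card_zorbit_eq]).  The transitive actions on
    [U] are classified by the stabiliser of the base point [x]: it can be any
    subgroup of index [#|U|] ([zstab_index], [exists_transitive]), and the actions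
    with a given stabiliser form a single free orbit under conjugation by the
    permutations of [U] that fix [x] ([conj_tuple_inj], [same_zstab_conj]).  So
    there are [(#|U| - 1)! * j_#|U|] of them ([card_transitive_on]).  Summing over
    [x] and [U] gives [m h_m = \sum_k 'C(m, k) k! j_k h_(m - k)]
    ([card_commuting_on_rec]), which is the recurrence for [h_m / m!].

    On the side of the partitions, the recurrence for
    [\sum_a \prod_i (j_i / i) ^ a_i / a_i!] follows by writing the factor [m] as
    [\sum_k k a_k] and removing one part equal to [k] in the [k]-th summand
    ([partition_sum_rec]). *)

(** * The action of Z^s defined by a commuting tuple *)

Definition zexpg (gT : finGroupType) (g : gT) (z : int) : gT :=
  match z with Posz n => (g ^+ n)%g | Negz n => (g ^- n.+1)%g end.

Lemma zexpgS (gT : finGroupType) (g : gT) (z : int) :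
  zexpg g (z + 1) = (zexpg g z * g)%g.
Proof.
case: z => n; first by rewrite -PoszD addn1 /= expgSr.
case: n => [|n]; first by rewrite /= expg1 mulVg.
have -> : Negz n.+1 + 1 = Negz n by rewrite !NegzE -addn1 PoszD opprD addrNK.
by rewrite /= [in RHS]expgS invMg mulgKV.
Qed.

Lemma zexpgD (gT : finGroupType) (g : gT) (z w : int) :
  zexpg g (z + w) = (zexpg g z * zexpg g w)%g.
Proof.
elim: w => [|n IHn|n IHn]; first by rewrite addr0 mulg1.
  by rewrite -addn1 PoszD addrA !zexpgS IHn mulgA.
apply: (mulIg g); rewrite -mulgA -!zexpgS -addrA.
by rewrite -addn1 PoszD opprD addrNK IHn.
Qed.

Lemma zexpg_morph (gT rT : finGroupType) (D : {group gT})
    (f : {morphism D >-> rT}) (g : gT) (z : int) :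
  g \in D -> f (zexpg g z) = zexpg (f g) z.
Proof.
by move=> gD; case: z => n /=; rewrite ?morphV ?groupX // morphX.
Qed.

Lemma mem_zexpg (gT : finGroupType) (G : {group gT}) (g : gT) (z : int) :
  g \in G -> zexpg g z \in G.
Proof. by case: z => n gG /=; rewrite ?groupV groupX. Qed.

Definition zact (gT : finGroupType) (s : nat) (t : s.-tuple gT)
    (v : 'rV[int]_s) : gT :=
  (\prod_(i < s) zexpg (tnth t i) (v ord0 i))%g.

Definition commuting (gT : finGroupType) (s : nat) (t : s.-tuple gT) : Prop :=
  forall i j, commute (tnth t i) (tnth t j).

(** The group [gT] need not be commutative, so that [big_split] does not apply:
    only the factors commute, being taken in an abelian subgroup. *)
Lemma prodgM_abelian (gT : finGroupType) (G : {group gT}) (I : Type)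
    (r : seq I) (a b : I -> gT) : abelian G ->
  (forall i, a i \in G) -> (forall i, b i \in G) ->
  (\prod_(i <- r) (a i * b i) = \prod_(i <- r) a i * \prod_(i <- r) b i)%g.
Proof.
move=> abG aG bG; elim: r => [|i r IHr]; first by rewrite !big_nil mulg1.
rewrite !big_cons IHr -!mulgA; congr (_ * _)%g; rewrite !mulgA; congr (_ * _)%g.
by apply: (centsP abG) => //; apply: group_prod.
Qed.

Lemma zact0 (s : nat) (gT : finGroupType) (t : s.-tuple gT) : zact t 0 = 1%g.
Proof. by apply: big1 => i _; rewrite mxE. Qed.

Lemma zactD (gT : finGroupType) (s : nat) (t : s.-tuple gT) (u v : 'rV[int]_s) :
  commuting t -> zact t (u + v) = (zact t u * zact t v)%g.
Proof.
move=> ct; pose G := <<[set tnth t i | i : 'I_s]>>%G.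
have abG : abelian G.
  rewrite /= abelian_gen; apply/centsP => x /imsetP[i _ ->] y /imsetP[j _ ->].
  exact: ct.
have tG i w : zexpg (tnth t i) w \in G.
  by apply/mem_zexpg/mem_gen/imset_f.
rewrite /zact -(prodgM_abelian _ abG) //.
by apply: eq_bigr => i _; rewrite mxE zexpgD.
Qed.

Lemma zact_morph (gT rT : finGroupType) (D : {group gT})
    (f : {morphism D >-> rT}) (s : nat) (t : s.-tuple gT) (v : 'rV[int]_s) :
  (forall i, tnth t i \in D) -> zact (map_tuple f t) v = f (zact t v).
Proof.
move=> tD; rewrite morph_prod => [|i _]; last exact: mem_zexpg.
by apply: eq_bigr => i _; rewrite tnth_map zexpg_morph.
Qed.

Lemma mem_zact (gT : finGroupType) (G : {group gT}) (s : nat)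
    (t : s.-tuple gT) (v : 'rV[int]_s) :
  (forall i, tnth t i \in G) -> zact t v \in G.
Proof. by move=> tG; apply: group_prod => i _; apply: mem_zexpg. Qed.

(** Z^s is free on its standard basis: a homomorphism is recovered from its
    values on the basis.  This lets an action be built from any additive family
    of permutations, without mentioning powers. *)
Lemma zact_hom (gT : finGroupType) (s : nat) (f : 'rV[int]_s -> gT)
    (v : 'rV[int]_s) : {morph f : u v / u + v >-> (u * v)%g} ->
  zact [tuple f (delta_mx 0 i) | i < s] v = f v.
Proof.
move=> fD; have f0 : f 0 = 1%g.
  by apply: (mulgI (f 0)); rewrite -fD addr0 mulg1.
have fZ u z : f (z *: u) = zexpg (f u) z.
  have fS y : f ((y + 1) *: u) = (f (y *: u)%R * f u)%g.
    by rewrite scalerDl scale1r fD.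
  elim: z => [|n IHn|n IHn]; first by rewrite scale0r f0.
    by rewrite intS addrC fS zexpgS IHn.
  apply: (mulIg (f u)); rewrite -fS -zexpgS.
  by rewrite intS opprD addrAC addNr add0r IHn.
rewrite [in RHS](row_sum_delta v) (big_morph f fD f0).
by apply: eq_bigr => i _; rewrite fZ tnth_mktuple.
Qed.

Lemma zact_delta (gT : finGroupType) (s : nat) (t : s.-tuple gT) (i : 'I_s) :
  zact t (delta_mx 0 i) = tnth t i.
Proof.
rewrite /zact -[RHS](big_pred1_eq mulg i (tnth t)).
rewrite [RHS]big_mkcond; apply: eq_bigr => j _; rewrite mxE eqxx /=.
by case: eqP => //= _; rewrite expg1.
Qed.

(** * Index of a subgroup as the size of a fibration *)

(** Both ranges are the quotient of [V] by the same equivalence relation. *)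
Lemma card_eq_range (V X : choiceType) (v0 : V) (f : V -> X) (g : V -> nat) :
  (forall u v, f u = f v <-> g u = g v) ->
  (range f #= range g)%card.
Proof.
move=> fg; apply/card_set_bijP.
pose h x := g (xget v0 (fun v => f v = x)).
have hf v : h (f v) = g v.
  by apply/fg; apply: (@xgetPex _ v0 (fun w => f w = f v)); exists v.
exists h; split=> [x [v _ <-]|x y /set_mem[u _ <-] /set_mem[v _ <-]|_ [v _ <-]].
- by exists v.
- by rewrite !hf => /fg.
- by exists (f v); [exists v | rewrite hf].
Qed.

Lemma eq_cosets (V : zmodType) (H : set V) (u v : V) : subgroup H ->
  ([set u + h | h in H]%classic = [set v + h | h in H]%classic) <-> H (u - v).
Proof.
move=> [H0 HB]; have {}HB x y : H x -> H y -> H (x - y).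
  by move=> Hx Hy; apply/set_mem/HB; apply/mem_set.
have {}H0 : H 0 by apply/set_mem.
have HN x : H x -> H (- x) by move=> Hx; rewrite -[- x]add0r; apply: HB.
split=> [E|Huv].
  have : [set u + h | h in H]%classic u by exists 0; rewrite ?addr0.
  by rewrite E => -[h Hh <-]; rewrite addrAC subrr add0r.
apply/seteqP; split=> _ [h Hh <-].
  exists (u - v + h); last by rewrite addrA addrCA subrr addr0.
  by rewrite -[h]opprK; apply/HB/HN.
exists (- (u - v - h)); first exact/HN/HB.
by rewrite !opprB addrCA (addrC u) subrK addrC.
Qed.

(** With its converse [index_fibration], this replaces the cosets of [H] by the
    points of a finite set [U]: the index of [H] is [#|U|] exactly when the cosets
    are the fibres of some surjection onto [U], for instance of an orbit map. *)
Lemma fibration_index (V : zmodType) (H : set V) (T : finType) (U : {set T})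
    (phi : V -> T) : subgroup H ->
  (forall u v, phi u = phi v <-> H (u - v)) ->
  (forall y, y \in U <-> exists v, phi v = y) -> has_index H #|U|.
Proof.
move=> sH phiH phiU; pose g v := index (phi v) (enum U).
have phi_in v : phi v \in enum U by rewrite mem_enum; apply/phiU; exists v.
apply: (@card_eq_trans _ _ _ _ (range g)).
  apply: (card_eq_range 0) => u v; apply: (iff_trans (eq_cosets u v sH)).
  apply: (iff_trans (iff_sym (phiH u v))); rewrite /g.
  by split=> [->|] //; apply: (index_inj (phi u)).
suff -> : range g = `I_#|U|%classic by [].
apply/seteqP; split=> [_ [v _ <-]|k /= kU].
  by rewrite /g /= cardE index_mem.
rewrite cardE in kU; have x0 : T by case: (enum U) kU => [|x0].
have /phiU[v vE] : nth x0 (enum U) k \in U by rewrite -mem_enum mem_nth.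
by exists v; rewrite // /g vE index_uniq ?enum_uniq.
Qed.

(** The base point [x] can be prescribed because any surjection onto [U] may be
    corrected by the transposition of [x] and the image of [0]. *)
Lemma index_fibration (V : zmodType) (H : set V) (T : finType) (U : {set T})
    (x : T) : subgroup H -> has_index H #|U| -> x \in U ->
  exists phi : V -> T, [/\ phi 0 = x,
    forall u v, phi u = phi v <-> H (u - v) &
    forall y, y \in U <-> exists v, phi v = y].
Proof.
move=> sH /card_set_bijP[f [fI finj fsurj]] xU.
pose coset u := [set u + h | h in H]%classic.
have fcoset v : (f (coset v) < size (enum U))%N.
  by rewrite -cardE; apply: fI; exists v.
pose psi v := nth x (enum U) (f (coset v)).
have psiH u v : psi u = psi v <-> H (u - v).
  apply: iff_trans (eq_cosets u v sH); rewrite /psi -!/(coset _); split=> [|-> //].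
  move=> /eqP; rewrite nth_uniq ?enum_uniq // => /eqP E.
  by apply: finj => //; apply/mem_set; [exists u | exists v].
have psiU y : y \in U <-> exists v, psi v = y.
  split=> [yU|[v <-]]; last by rewrite -mem_enum mem_nth.
  have [|_ [v _ <-] E] := fsurj (index y (enum U)).
    by rewrite /= cardE index_mem mem_enum.
  by exists v; rewrite /psi -/(coset v) in E *; rewrite E nth_index ?mem_enum.
have U0 : psi 0 \in U by apply/psiU; exists 0.
exists (fun v => tperm (psi 0) x (psi v)); split=> [|u v|y].
- by rewrite tpermL.
- by split=> [/perm_inj/psiH //|/psiH ->].
- have -> : (y \in U) = (tperm (psi 0) x y \in U).
    by case: tpermP => [->|->|_ _] //; rewrite U0 xU.
  apply: (iff_trans (psiU _)); split=> -[v].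
    by move=> E; exists v; rewrite E tpermK.
  by move<-; exists v; rewrite tpermK.
Qed.

(** * Commuting tuples of permutations, orbits and stabilisers *)

(** Permutations of subsets of [T] are encoded as permutations of [T] supported
    in them, so that an action can be cut along an orbit without change of
    type. *)
Definition commuting_on (s : nat) (T : finType) (S : {set T}) :
    {set s.-tuple {perm T}} :=
  [set t | [forall i, perm_on S (tnth t i)] &&
    [forall i, forall j,
      (tnth t i * tnth t j == tnth t j * tnth t i)%g]].

Lemma commuting_onP (s : nat) (T : finType) (S : {set T})
    (t : s.-tuple {perm T}) :
  reflect ((forall i, perm_on S (tnth t i)) /\ commuting t)
          (t \in commuting_on s S).
Proof.
rewrite inE; apply: (iffP andP) => -[tS ct]; split; first exact/forallP.
- by move=> i j; apply/eqP; move/forallP/(_ i)/forallP: ct.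
- exact/forallP.
- by apply/forallP => i; apply/forallP => j; apply/eqP/ct.
Qed.

Definition zorbit (s : nat) (T : finType) (t : s.-tuple {perm T}) (x : T) :
    {set T} :=
  [set y | `[< exists v, zact t v x = y >]].

Definition zstab (s : nat) (T : finType) (t : s.-tuple {perm T}) (x : T) :
    set 'rV[int]_s :=
  [set v | zact t v x = x]%classic.

Lemma zorbitP (s : nat) (T : finType) (t : s.-tuple {perm T}) (x y : T) :
  y \in zorbit t x <-> exists v, zact t v x = y.
Proof. by rewrite inE; split=> /asboolP. Qed.

Lemma zorbit_refl (s : nat) (T : finType) (t : s.-tuple {perm T}) (x : T) :
  x \in zorbit t x.
Proof. by apply/zorbitP; exists 0; rewrite zact0 perm1. Qed.

Lemma zact_add (s : nat) (T : finType) (t : s.-tuple {perm T}) (x : T) u v :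
  commuting t -> zact t v (zact t u x) = zact t (u + v) x.
Proof. by move=> ct; rewrite zactD // permM. Qed.

Lemma zact_step (s : nat) (T : finType) (t : s.-tuple {perm T}) (x : T) v i :
  commuting t -> tnth t i (zact t v x) = zact t (v + delta_mx 0 i) x.
Proof. by move=> ct; rewrite -zact_add // zact_delta. Qed.

Lemma zact_eq (s : nat) (T : finType) (t : s.-tuple {perm T}) (x : T) u v :
  commuting t -> zact t u x = zact t v x <-> zstab t x (u - v).
Proof.
move=> ct; rewrite /zstab /= -[in X in X <-> _](subrK v u).
rewrite -[zact t (_ + v) x]zact_add //.
by split=> [/perm_inj|->].
Qed.

Lemma zstab_subgroup (s : nat) (T : finType) (t : s.-tuple {perm T}) (x : T) :
  commuting t -> subgroup (zstab t x).
Proof.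
move=> ct; split; first by apply/mem_set; rewrite /zstab /= zact0 perm1.
move=> u v /set_mem ux /set_mem vx; apply/mem_set/zact_eq => //.
by rewrite ux vx.
Qed.

Definition transitive_on (s : nat) (T : finType) (U : {set T}) (x : T) :
    {set s.-tuple {perm T}} :=
  [set t in commuting_on s U | zorbit t x == U].

Lemma transitive_onP (s : nat) (T : finType) (U : {set T}) (x : T)
    (t : s.-tuple {perm T}) :
  reflect [/\ forall i, perm_on U (tnth t i), commuting t & zorbit t x = U]
          (t \in transitive_on s U x).
Proof.
apply: (iffP setIdP) => [[/commuting_onP[tU ct] /eqP]|[tU ct /eqP oU]] //.
by split=> //; apply/commuting_onP.
Qed.

Lemma zstab_index (s : nat) (T : finType) (t : s.-tuple {perm T}) (x : T) :
  commuting t -> has_index (zstab t x) #|zorbit t x|.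
Proof.
move=> ct; apply: (fibration_index (phi := fun v => zact t v x)).
- exact: zstab_subgroup.
- by move=> u v; apply: zact_eq.
- by move=> y; apply: zorbitP.
Qed.

(** * Transitive actions with a base point *)

(** Transport to [U] the translation action of Z^s on Z^s / H, along a fibration
    of Z^s over [U] with fibres the cosets of [H]. *)
Lemma exists_transitive (s : nat) (T : finType) (U : {set T}) (x : T)
    (H : set 'rV[int]_s) : subgroup H -> has_index H #|U| -> x \in U ->
  exists2 t, t \in transitive_on s U x & zstab t x = H.
Proof.
move=> sH iH xU.
have [phi [phi0 phiH phiU]] := index_fibration sH iH xU.
(* translation by [w]: lift to Z^s, translate, project back; the choice of the
   lift is immaterial by [phiH] *)
pose f w y := if y \in U then phi (xget 0 (fun v => phi v = y) + w) else y.
have fE w v : f w (phi v) = phi (v + w).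
  have -> : f w (phi v) = phi (xget 0 (fun u => phi u = phi v) + w).
    by rewrite /f ifT //; apply/phiU; exists v.
  apply/phiH; rewrite opprD addrACA subrr addr0; apply/phiH.
  by apply: (@xgetPex _ 0 (fun u => phi u = phi v)); exists v.
have fD u v y : f (u + v) y = f v (f u y).
  have [/phiU[w <-]|yU] := boolP (y \in U); first by rewrite !fE addrA.
  by rewrite /f (negPf yU) (negPf yU).
have f0 y : f 0 y = y.
  have [/phiU[w <-]|yU] := boolP (y \in U); first by rewrite fE addr0.
  by rewrite /f (negPf yU).
have f_inj w : injective (f w).
  by apply: (can_inj (g := f (- w))) => y; rewrite -fD subrr f0.
pose p w := perm (@f_inj w).
have pD : {morph p : u v / u + v >-> (u * v)%g}.
  by move=> u v; apply/permP => y; rewrite permM !permE fD.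
pose t := [tuple p (delta_mx 0 i) | i < s].
have tE v : zact t v x = phi v.
  by rewrite zact_hom // permE -phi0 fE add0r.
have ct : commuting t.
  by move=> i j; rewrite !tnth_mktuple /commute -!pD addrC.
exists t; last first.
  by apply/seteqP; split=> v; rewrite /zstab /= tE -phi0 -[v in H v]subr0;
    move/phiH.
apply/transitive_onP; split=> // [i|].
  apply/fintype.subsetP => y; rewrite inE tnth_mktuple permE /f.
  by case: ifP => // _; rewrite eqxx.
apply/setP => y; apply/idP/idP => [/zorbitP[v <-]|/phiU[v <-]].
  by rewrite tE; apply/phiU; exists v.
by apply/zorbitP; exists v.
Qed.

Definition conj_tuple (gT : finGroupType) (s : nat) (p : gT) (t : s.-tuple gT) :
  s.-tuple gT := map_tuple (fun g => g ^ p)%g t.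

Lemma zact_conj (gT : finGroupType) (s : nat) (t : s.-tuple gT) (p : gT) v :
  zact (conj_tuple p t) v = (zact t v ^ p)%g.
Proof.
apply: (zact_morph (conjgm_morphism [set: gT] p)).
by move=> i; apply: finset.in_setT.
Qed.

Lemma commuting_conj (gT : finGroupType) (s : nat) (t : s.-tuple gT) (p : gT) :
  commuting t -> commuting (conj_tuple p t).
Proof. by move=> ct i j; rewrite !tnth_map /commute -!conjMg ct. Qed.

Section ConjFibre.
Variables (s : nat) (T : finType) (U : {set T}) (x : T).

Lemma zact_conj_fix (t : s.-tuple {perm T}) (p : {perm T}) v :
  perm_on (U :\ x) p -> zact (conj_tuple p t) v x = p (zact t v x).
Proof.
move=> pU; have px : p x = x by apply: (out_perm pU); rewrite !inE eqxx.
by rewrite zact_conj -{1}px permJ.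
Qed.

Lemma transitive_conj (t : s.-tuple {perm T}) (p : {perm T}) :
  t \in transitive_on s U x -> perm_on (U :\ x) p ->
  conj_tuple p t \in transitive_on s U x /\ zstab (conj_tuple p t) x = zstab t x.
Proof.
move=> /transitive_onP[tU ct oU] pU.
have pU' : perm_on U p by apply: (fintype.subset_trans pU); apply: subD1set.
have px : p x = x by apply: (out_perm pU); rewrite !inE eqxx.
split.
  apply/transitive_onP; split; last 1 first.
  - apply/setP => y; rewrite -[in RHS](im_perm_on pU') -[in RHS]oU.
    apply/idP/imsetP => [/zorbitP[v]|[z /zorbitP[v <-] ->]].
      rewrite zact_conj_fix // => <-; exists (zact t v x) => //.
      by apply/zorbitP; exists v.
    by apply/zorbitP; exists v; rewrite zact_conj_fix.
  - by move=> i; rewrite tnth_map !perm_onM ?perm_onV.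
  - exact: commuting_conj.
apply/seteqP; split=> v; rewrite /zstab /= zact_conj_fix //; last by move->.
by rewrite -[x in _ = x]px => /perm_inj.
Qed.

(** A conjugator that fixes [x] is determined by the conjugated tuple, since it
    sends [zact t v x] to [zact (conj_tuple p t) v x] and all points of [U] have
    the form [zact t v x]. *)
Lemma conj_tuple_inj (t : s.-tuple {perm T}) :
  t \in transitive_on s U x ->
  {in [set p | perm_on (U :\ x) p] &, injective (fun p => conj_tuple p t)}.
Proof.
move=> /transitive_onP[_ _ oU] p q; rewrite !inE => pU qU E.
apply/permP => y; have [|yU] := boolP (y \in U).
  by rewrite -oU => /zorbitP[v <-]; rewrite -!zact_conj_fix // E.
have yU' : y \notin U :\ x by rewrite !inE (negPf yU) andbF.
by rewrite (out_perm pU) // (out_perm qU).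
Qed.

(** If the stabilisers agree then [zact t v x |-> zact t' v x] is well defined on
    [U]; it intertwines the two actions, and exchanging them gives its
    inverse. *)
Lemma same_zstab_conj (t t' : s.-tuple {perm T}) :
  t \in transitive_on s U x -> t' \in transitive_on s U x ->
  zstab t' x = zstab t x ->
  exists2 p, perm_on (U :\ x) p & t' = conj_tuple p t.
Proof.
pose f (t t' : s.-tuple {perm T}) y :=
  if y \in U then zact t' (xget 0 (fun v => zact t v x = y)) x else y.
have fE t1 t2 v : t1 \in transitive_on s U x -> t2 \in transitive_on s U x ->
    zstab t2 x = zstab t1 x -> f t1 t2 (zact t1 v x) = zact t2 v x.
  move=> /transitive_onP[_ c1 oU] /transitive_onP[_ c2 _] E.
  rewrite /f ifT -?oU; last by apply/zorbitP; exists v.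
  apply/zact_eq; rewrite // E; apply/zact_eq => //.
  by apply: (@xgetPex _ 0 (fun u => zact t1 u x = zact t1 v x)); exists v.
have fN t1 t2 y : y \notin U -> f t1 t2 y = y by rewrite /f => /negPf ->.
have fK t1 t2 : t1 \in transitive_on s U x -> t2 \in transitive_on s U x ->
    zstab t2 x = zstab t1 x -> cancel (f t1 t2) (f t2 t1).
  move=> tr1 tr2 E y; have [yU|yU] := boolP (y \in U); last by rewrite !fN.
  have /transitive_onP[_ _ oU] := tr1.
  by move: yU; rewrite -oU => /zorbitP[v <-]; rewrite !fE.
move=> tr tr' E; pose p := perm (can_inj (fK _ _ tr tr' E)).
have /transitive_onP[tU ct oU] := tr; have /transitive_onP[t'U ct' _] := tr'.
exists p.
  apply/fintype.subsetP => y; rewrite !inE permE; apply: contraR.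
  rewrite negb_and negbK => /orP[/eqP->|/fN->//].
  by rewrite -[x in f _ _ x](perm1 x) -(zact0 t) fE // zact0 perm1.
apply: eq_from_tnth => i; rewrite tnth_map.
apply: (mulgI p); rewrite -conjgC; apply/permP => y; rewrite !permM !permE.
have [|yU] := boolP (y \in U).
  by rewrite -oU => /zorbitP[v <-]; rewrite fE // !zact_step // fE.
by rewrite fN // (out_perm (tU i)) // (out_perm (t'U i)) // fN.
Qed.

Lemma card_conj_fibre (t : s.-tuple {perm T}) : x \in U ->
  t \in transitive_on s U x ->
  #|[set t' in transitive_on s U x | zstab t' x == zstab t x]| = (#|U|.-1)`!.
Proof.
move=> xU tr.
have -> : (#|U|.-1)`! = #|[set p | perm_on (U :\ x) p]|.
  by rewrite cardsE card_perm [in LHS](cardsD1 x) xU.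
rewrite -(card_in_imset (conj_tuple_inj tr)); congr #|pred_of_set _|.
apply/setP => t'; rewrite inE; apply/andP/imsetP => [[tr' /eqP E]|[p]].
  by have [p pU ->] := same_zstab_conj tr tr' E; exists p; rewrite ?inE.
rewrite inE => pU ->; have [? ->] := transitive_conj tr pU.
by split.
Qed.

(** The map sending a tuple to the stabiliser of [x] goes onto the subgroups of
    index [#|U|], which are therefore finite in number, and its fibres all have
    size [(#|U|.-1)`!]. *)
Lemma card_transitive_on : x \in U ->
  #|transitive_on s U x| = ((#|U|.-1)`! * subgroup_count s #|U|)%N.
Proof.
move=> xU; pose A : set (set 'rV[int]_s) :=
  [set H | subgroup H /\ has_index H #|U|]%classic.
pose st (t : s.-tuple {perm T}) := zstab t x.
have AE : A = [set st t | t in [set` transitive_on s U x]]%classic.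
  apply/seteqP; split=> [H [sH iH]|_ [t /= /transitive_onP[tU ct oU] <-]].
    by have [t tr <-] := exists_transitive sH iH xU; exists t.
  by split; [apply: zstab_subgroup | rewrite -oU; apply: zstab_index].
have finA : finite_set A by rewrite AE; apply/finite_image/finite_finset.
rewrite /subgroup_count -/A -sum1_card.
transitivity (\sum_(H <- fset_set A)
    \sum_(t in transitive_on s U x) (st t == H : nat))%N.
  rewrite exchange_big; apply: eq_bigr => t tr /=.
  have tA : st t \in fset_set A.
    by rewrite in_fset_set // AE; apply/mem_set; exists t.
  rewrite (bigD1_seq (st t)) ?fset_uniq //= eqxx big1_seq //.
  by move=> H /andP[/negPf]; rewrite eq_sym => ->.
rewrite (eq_big_seq (fun=> (#|U|.-1)`!)) => /=; last first.
  move=> H; rewrite in_fset_set // AE => /set_mem[t tr <-].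
  rewrite -(card_conj_fibre xU tr) -sum1_card big_mkcond /=.
  rewrite [in RHS]big_mkcond /=; apply: eq_bigr => t' _; rewrite !inE.
  by rewrite /st; case: (_ && _); case: eqP.
by rewrite big_const_seq count_predT iter_addn_0.
Qed.
End ConjFibre.

(** * Cutting an action along an orbit *)

Lemma mem_astabsP (T : finType) (U : {set T}) (p : {perm T}) :
  (forall y, y \in U -> p y \in U) -> p \in 'N(U | 'P)%g.
Proof.
by move=> pU; rewrite !inE; apply/fintype.subsetP => y yU; rewrite inE; apply: pU.
Qed.

(** The stability of [U] under [r] comes for free, as [r] agrees on [U] with a
    permutation supported in [U]. *)
Lemma restr_perm_eq (T : finType) (U : {set T}) (p r : {perm T}) :
  perm_on U p -> {in U, r =1 p} -> restr_perm U r = p.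
Proof.
move=> pU E.
have rN : r \in 'N(U | 'P)%g.
  by apply: mem_astabsP => y yU; rewrite E // perm_closed.
apply/permP => y; have [yU|yU] := boolP (y \in U); first by rewrite restr_permE ?E.
by rewrite (out_perm pU) // (out_perm (restr_perm_on U r)).
Qed.

Section Split.
Variables (s : nat) (T : finType).

Lemma zorbit_restr (U : {set T}) (t : s.-tuple {perm T}) (x : T) :
  (forall i, tnth t i \in 'N(U | 'P)%g) -> x \in U ->
  zorbit (map_tuple (restr_perm U) t) x = zorbit t x.
Proof.
move=> tN xU; suff E v : zact (map_tuple (restr_perm U) t) v x = zact t v x.
  by apply/setP => y; apply/idP/idP => /zorbitP[v <-];
    apply/zorbitP; exists v; rewrite E.
have := zact_morph (restr_perm_morphism U) v tN; rewrite /= => ->.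
by rewrite restr_permE //; apply: mem_zact.
Qed.

Lemma commuting_restr (U : {set T}) (t : s.-tuple {perm T}) :
  (forall i, tnth t i \in 'N(U | 'P)%g) -> commuting t ->
  commuting (map_tuple (restr_perm U) t).
Proof. by move=> tN ct i j; rewrite !tnth_map /commute -!morphM // ct. Qed.

Definition mul_tuple (tt : s.-tuple {perm T} * s.-tuple {perm T}) :
    s.-tuple {perm T} :=
  [tuple (tnth tt.1 i * tnth tt.2 i)%g | i < s].

Variables (S U : {set T}) (x : T).
Hypotheses (US : U \subset S) (xU : x \in U).

(** Restriction to [U] and to its complement undoes the gluing of an action on [U]
    with one on [S :\: U]. *)
Lemma mul_tupleK :
  {in finset.setX (commuting_on s U) (commuting_on s (S :\: U)), forall tt,
    map_tuple (restr_perm U) (mul_tuple tt) = tt.1 /\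
    map_tuple (restr_perm (~: U)) (mul_tuple tt) = tt.2}.
Proof.
move=> [t1 t2] /finset.setXP[/= /commuting_onP[t1U _] /commuting_onP[t2U _]].
split; apply: eq_from_tnth => i; rewrite tnth_map tnth_mktuple /=;
  apply: restr_perm_eq => //.
- by move=> y yU; rewrite permM (out_perm (t2U i)) // !inE perm_closed // yU.
- apply: fintype.subset_trans (t2U i) _; apply/fintype.subsetP => y.
  by rewrite !inE => /andP[].
- by move=> y; rewrite inE => yU; rewrite permM (out_perm (t1U i)).
Qed.

(** The gluing map [mul_tuple] is a bijection from pairs (transitive action on
    [U], action on [S :\: U]) to the actions on [S] for which the orbit of [x] is
    [U]; its inverse is given by restriction. *)
Lemma card_zorbit_eq :
  #|[set t in commuting_on s S | zorbit t x == U]| =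
  (#|transitive_on s U x| * #|commuting_on s (S :\: U)|)%N.
Proof.
pose D := finset.setX (transitive_on s U x) (commuting_on s (S :\: U)).
have DX tt : tt \in D ->
    tt \in finset.setX (commuting_on s U) (commuting_on s (S :\: U)).
  case: tt => t1 t2 /finset.setXP[/transitive_onP[tU ct _] t2U].
  apply/finset.setXP; split=> //.
  exact/commuting_onP.
have mulI : {in D &, injective mul_tuple}.
  move=> [a b] [c d] /DX/mul_tupleK[/= Ea Eb] /DX/mul_tupleK[/= Ec Ed] E.
  by congr pair; [rewrite -Ea E Ec | rewrite -Eb E Ed].
rewrite -cardsX -(card_in_imset mulI); congr #|pred_of_set _|.
apply/setP => t; apply/setIdP/imsetP => [[/commuting_onP[tS ct] /eqP oU]|].
  have tN i : tnth t i \in 'N(U | 'P)%g.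
    apply: mem_astabsP => y; rewrite -oU => /zorbitP[v <-].
    by apply/zorbitP; exists (v + delta_mx 0 i); rewrite zact_step.
  have tNC i : tnth t i \in 'N(~: U | 'P)%g by rewrite astabsC.
  exists (map_tuple (restr_perm U) t, map_tuple (restr_perm (~: U)) t).
    apply/finset.setXP; split.
      apply/transitive_onP; split; last by rewrite zorbit_restr.
        by move=> i; rewrite tnth_map restr_perm_on.
      exact: commuting_restr.
    apply/commuting_onP; split=> [i|]; last exact: commuting_restr.
    rewrite tnth_map; apply/fintype.subsetP => y; apply: contraR.
    rewrite finset.in_setD negb_and negbK => /orP[yU|yS].
      by rewrite (out_perm (restr_perm_on _ _)) // inE yU.
    rewrite restr_permE ?(out_perm (tS i)) // inE.
    by apply: contra yS; apply: (fintype.subsetP US).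
  apply: eq_from_tnth => i; rewrite tnth_mktuple !tnth_map /=.
  apply/permP => y; rewrite permM; have [yU|yU] := boolP (y \in U).
    rewrite [restr_perm U _ y]restr_permE // (out_perm (restr_perm_on (~: U) _)) //.
    by rewrite -(astabs_act _ (tN i)) in yU; rewrite inE negbK.
  by rewrite (out_perm (restr_perm_on U _)) // restr_permE // inE.
case=> -[t1 t2] tD ->; have [E1 E2] := mul_tupleK (DX _ tD).
move: tD => /finset.setXP[/= /transitive_onP[t1U c1 o1] /commuting_onP[t2U c2]].
have t12 i j : commute (tnth t1 i) (tnth t2 j).
  apply: perm_onC (t1U i) (t2U j) _.
  by rewrite -setI_eq0; apply/eqP/setP => y; rewrite !inE; case: (y \in U).
have t1S i : perm_on S (tnth t1 i) by apply: fintype.subset_trans (t1U i) US.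
have t2S i : perm_on S (tnth t2 i).
  by apply: fintype.subset_trans (t2U i) _; apply: subsetDl.
split.
  apply/commuting_onP; split=> i; first by rewrite tnth_mktuple perm_onM.
  move=> j; rewrite !tnth_mktuple /=; apply: commuteM; apply: commute_sym;
    apply: commuteM; do ?[exact: c1 | exact: c2 | exact: t12];
    exact/commute_sym/t12.
apply/eqP; rewrite -[RHS]o1 -[t1 in RHS]E1 zorbit_restr // => i.
apply: mem_astabsP => y yU; rewrite tnth_mktuple permM (out_perm (t2U i)).
  by rewrite perm_closed.
by rewrite !inE perm_closed // yU.
Qed.
End Split.

(** Double count of the pairs (tuple, point of [S]), sorted by the orbit [U] of
    the point. *)
Lemma card_commuting_on_rec (s : nat) (T : finType) (S : {set T}) :
  (#|S| * #|commuting_on s S| =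
   \sum_(U : {set T} | U \subset S)
     #|U| * ((#|U|.-1)`! * subgroup_count s #|U| * #|commuting_on s (S :\: U)|))%N.
Proof.
rewrite -sum_nat_const.
transitivity (\sum_(x in S) \sum_(U : {set T} | (U \subset S) && (x \in U))
    (#|U|.-1)`! * subgroup_count s #|U| * #|commuting_on s (S :\: U)|)%N.
  apply: eq_bigr => x xS; rewrite -sum1_card.
  rewrite (partition_big (fun t => zorbit t x)
            (fun U : {set T} => (U \subset S) && (x \in U))) /=.
    apply: eq_bigr => U /andP[US xU].
    rewrite -(card_transitive_on s xU) -card_zorbit_eq // -sum1_card.
    by apply: eq_bigl => t; rewrite [in RHS]inE.
  move=> t /commuting_onP[tS ct]; rewrite zorbit_refl andbT.
  apply/fintype.subsetP => y /zorbitP[v <-].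
  have : zact t v \in 'N(S | 'P)%g.
    by apply: mem_zact => i; apply: mem_astabsP => z zS; rewrite perm_closed.
  by move/astabs_act => /= E; rewrite -[zact t v x]/('P%act x (zact t v)) E.
rewrite (exchange_big_dep (fun U : {set T} => U \subset S)) /=; last first.
  by move=> x U _ /andP[].
apply: eq_bigr => U US; rewrite -sum_nat_const; apply: eq_bigl => x.
by rewrite US /=; case xU: (x \in U); rewrite ?andbF // (fintype.subsetP US).
Qed.

Lemma commuting_on0 (s : nat) (T : finType) :
  #|commuting_on s (finset.set0 : {set T})| = 1%N.
Proof.
suff -> : commuting_on s (finset.set0 : {set T}) = [set [tuple 1%g | i < s]].
  by rewrite cards1.
apply/setP => t; apply/commuting_onP/finset.set1P => [[t0 _]|->].
  apply: eq_from_tnth => i; rewrite tnth_mktuple.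
  by apply: (perm_on_id (t0 i)); rewrite cards0.
by split=> [i|i j]; rewrite !tnth_mktuple ?perm_on1.
Qed.

(** * The sum over partitions *)

Section PartitionSum.
Variables (F : numFieldType) (w : nat -> F) (N : nat).

Definition mult_weight (a : {ffun 'I_N -> 'I_N.+1}) : nat :=
  (\sum_(i < N) i.+1 * a i)%N.

Definition mult_term (a : {ffun 'I_N -> 'I_N.+1}) : F :=
  \prod_(i < N) ((w i.+1 / i.+1%:R) ^+ a i / (a i)`!%:R).

(** The bound [N] on the parts and multiplicities is kept separate from the
    weight [m], so that the recurrence relates sums over one index type; for
    [m <= N] it excludes no partition of [m]. *)
Definition partition_sum (m : nat) : F :=
  \sum_(a | mult_weight a == m) mult_term a.

(** [inord] overflows when [b k = N], which cannot happen if [b] has weight less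
    than [N]; hence the condition [b k < N] in the lemmas below. *)
Definition add_part (k : 'I_N) (b : {ffun 'I_N -> 'I_N.+1}) :=
  [ffun i => inord (b i + (i == k)) : 'I_N.+1].

Definition del_part (k : 'I_N) (a : {ffun 'I_N -> 'I_N.+1}) :=
  [ffun i => inord (a i - (i == k)) : 'I_N.+1].

Lemma del_partE k (a : {ffun 'I_N -> 'I_N.+1}) i :
  del_part k a i = (a i - (i == k))%N :> nat.
Proof. by rewrite ffunE inordK // ltnS (leq_trans (leq_subr _ _)) // -ltnS. Qed.

Lemma del_part_lt (k : 'I_N) a : (del_part k a k < N)%N.
Proof.
rewrite del_partE eqxx subn1; have := ltn_ord (a k).
by case: (nat_of_ord (a k)) => // _; apply: leq_ltn_trans (ltn_ord k).
Qed.

Lemma add_partE k (b : {ffun 'I_N -> 'I_N.+1}) i : (b k < N)%N ->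
  add_part k b i = (b i + (i == k))%N :> nat.
Proof.
move=> bk; rewrite ffunE inordK //; case: eqP => [->|_]; first by rewrite addn1 ltnS.
by rewrite addn0.
Qed.

Lemma leq_mult_weight (a : {ffun 'I_N -> 'I_N.+1}) (k : 'I_N) :
  (k.+1 * a k <= mult_weight a)%N.
Proof. by rewrite /mult_weight (bigD1 k) //= leq_addr. Qed.

Lemma mult_weight_add (k : 'I_N) (b : {ffun 'I_N -> 'I_N.+1}) : (b k < N)%N ->
  mult_weight (add_part k b) = (mult_weight b + k.+1)%N.
Proof.
move=> bk; rewrite /mult_weight (bigD1 k) //= [in RHS](bigD1 k) //=.
rewrite add_partE // eqxx addn1 mulnS -addnA addnC; congr (_ + _ + _)%N.
by apply: eq_bigr => i /negPf ik; rewrite add_partE // ik addn0.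
Qed.

Lemma mult_term_add (k : 'I_N) (b : {ffun 'I_N -> 'I_N.+1}) : (b k < N)%N ->
  (k.+1 * (b k).+1)%:R * mult_term (add_part k b) = w k.+1 * mult_term b.
Proof.
move=> bk; rewrite /mult_term (bigD1 k) //= [in RHS](bigD1 k) //= !mulrA.
rewrite add_partE // eqxx addn1; congr (_ * _).
  rewrite exprS factS !natrM.
  have k0 : (k.+1%:R : F) != 0 by rewrite pnatr_eq0.
  have b0 : ((b k).+1%:R : F) != 0 by rewrite pnatr_eq0.
  have f0 : ((b k)`!%:R : F) != 0 by rewrite pnatr_eq0 -lt0n fact_gt0.
  move: (_ ^+ b k) => x; move: k0 b0 f0.
  move: (k.+1%:R) ((b k).+1%:R) ((b k)`!%:R) (w k.+1) => c d e z c0 d0 e0.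
  by field; rewrite c0 d0 e0.
by apply: eq_bigr => i /negPf ik; rewrite add_partE // ik addn0.
Qed.

(** Expand [m] as [\sum_k k a_k]; in the summand of [k] only the partitions with a
    part [k] survive, and removing that part identifies them with the partitions
    of [m - k]. *)
Lemma partition_sum_rec m : (m <= N)%N ->
  m%:R * partition_sum m =
  \sum_(k < N | (k < m)%N) w k.+1 * partition_sum (m - k.+1).
Proof.
move=> mN; rewrite /partition_sum mulr_sumr.
transitivity (\sum_(a | mult_weight a == m) \sum_(k < N)
    (k.+1 * a k)%:R * mult_term a).
  by apply: eq_bigr => a /eqP <-; rewrite natr_sum mulr_suml.
rewrite exchange_big [RHS]big_mkcond; apply: eq_bigr => k _ /=.
rewrite (bigID (fun a : {ffun 'I_N -> 'I_N.+1} => a k == 0%N :> nat)) /=.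
rewrite big1 => [|a /andP[_ /eqP ->]]; last by rewrite muln0 mul0r.
rewrite add0r; case: ltnP => km; last first.
  apply: big1 => a /andP[/eqP am ak].
  have := leq_mult_weight a k; rewrite am leqNgt (leq_ltn_trans km) //.
  by rewrite -[X in (X < _)%N]muln1 in km *; nia.
(* an overflowing [b] is discarded by the condition that [del_part] inverts
   [add_part], which gives [b k < N] *)
rewrite mulr_sumr (reindex_onto (add_part k) (del_part k)) /=; last first.
  move=> a /andP[_ ak]; apply/ffunP => i; apply: val_inj.
  rewrite /= add_partE ?del_part_lt // del_partE; case: eqP => [->|_]; lia.
apply: eq_big => [b|b /andP[/andP[/eqP bm bk] /eqP bK]].
  apply/idP/eqP => [/andP[/andP[/eqP bm bk] /eqP bK]|bm].
    have bN : (b k < N)%N by rewrite -bK del_part_lt.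
    by rewrite -bm mult_weight_add // addnK.
  have bN : (b k < N)%N.
    by have := leq_mult_weight b k; rewrite bm; nia.
  rewrite mult_weight_add // add_partE // eqxx bm subnK // eqxx addn1 /=.
  apply/eqP/ffunP => i; apply: val_inj.
  by rewrite /= del_partE add_partE // addnK.
have bN : (b k < N)%N by rewrite -bK del_part_lt.
by rewrite -mult_term_add // add_partE // eqxx addn1.
Qed.

Lemma partition_sum0 : partition_sum 0 = 1.
Proof.
rewrite /partition_sum (big_pred1 [ffun=> ord0]) => [|a].
  by apply: big1 => i _; rewrite ffunE expr0 divr1.
apply/eqP/eqP => [a0|->].
  apply/ffunP => i; apply: val_inj; rewrite ffunE /=.
  by have := leq_mult_weight a i; rewrite a0 leqn0 muln_eq0 => /eqP.
by apply: big1 => i _; rewrite ffunE muln0.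
Qed.
End PartitionSum.

(** * The count of commuting tuples *)

Lemma sum_subsets (T : finType) (V : nmodType) (S : {set T}) (f : nat -> V) :
  \sum_(U : {set T} | U \subset S) f #|U| =
  \sum_(k < #|S|.+1) f k *+ 'C(#|S|, k).
Proof.
rewrite (partition_big (fun U : {set T} => inord #|U| : 'I_#|S|.+1) xpredT) //=.
apply: eq_bigr => k _; rewrite -cards_draws -sumr_const.
apply: eq_big => [U|U /andP[US /eqP <-]]; last first.
  by rewrite inordK // ltnS subset_leq_card.
rewrite inE; case US: (U \subset S) => //=.
by rewrite -val_eqE /= inordK // ltnS subset_leq_card.
Qed.

(** Strong induction on [#|S|]: after division by [(#|S|)`!] both sides satisfy
    the recurrence of [partition_sum_rec]. *)
Lemma card_commuting_on (F : numFieldType) (s N : nat) (T : finType)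
    (S : {set T}) : (#|S| <= N)%N ->
  #|commuting_on s S|%:R =
  (#|S|)`!%:R * partition_sum (fun r => (subgroup_count s r)%:R : F) N #|S|.
Proof.
have [m] := ubnP #|S|; elim: m S => // m IHm S; rewrite ltnS => Sm SN.
have [S0|S0] := posnP #|S|.
  by rewrite S0 (cards0_eq S0) commuting_on0 partition_sum0 mulr1.
have n0 : #|S|%:R != 0 :> F by rewrite pnatr_eq0 -lt0n.
apply: (mulfI n0); rewrite -natrM card_commuting_on_rec natr_sum.
rewrite mulrCA partition_sum_rec //.
pose w r : F := (subgroup_count s r)%:R.
(* the contribution of an orbit of size [k]; it vanishes for [k = 0], as it should
   since no orbit is empty *)
pose f k : F := (k * k.-1`!)%:R * w k * ((#|S| - k)`!%:R *
  partition_sum w N (#|S| - k)).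
transitivity (\sum_(U : {set T} | U \subset S) f #|U|).
  apply: eq_bigr => U US; rewrite /f.
  have [->|U0] := posnP #|U|; first by rewrite !mul0n !mul0r.
  have cSU : #|S :\: U| = (#|S| - #|U|)%N by rewrite cardsD (finset.setIidPr US).
  have SUlt : (#|S :\: U| < #|S|)%N by rewrite cSU; lia.
  rewrite !natrM IHm ?cSU ?mulrA //; rewrite ?cSU; lia.
rewrite sum_subsets big_ord_recl {1}/f mul0n !mul0r mul0rn add0r mulr_sumr.
rewrite -(big_ord_widen_cond N predT (fun k => (#|S|)`!%:R * (w k.+1 *
  partition_sum w N (#|S| - k.+1))) SN).
apply: eq_bigr => k _; rewrite /f lift0 /= -factS -mulr_natr.
rewrite -(bin_fact (ltn_ord k)) !natrM; ring.
Qed.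

Lemma commuting_tuplesE (s n : nat) :
  commuting_tuples s n = commuting_on s [set: 'I_n].
Proof.
apply/setP => t; rewrite !inE; symmetry; apply/andb_idl => _.
by apply/forallP => i; apply/fintype.subsetP => x _; rewrite inE.
Qed.

Theorem proposition5p1 (n s : nat) (hn : (0 < n)%N) (hs : (0 < s)%N) :
  #|commuting_tuples s n|%:R =
    \sum_(a in partitions n)
      n`!%:R / (\prod_(i < n) (i.+1%:R ^+ a i * (a i)`!%:R))
      * \prod_(i < n) (subgroup_count s i.+1)%:R ^+ a i :> rat.
Proof.
rewrite commuting_tuplesE (@card_commuting_on rat s n) cardsT card_ord //.
rewrite mulr_sumr; apply: eq_big => [a|a _]; first by rewrite inE.
rewrite -mulrA -prodfV -big_split /=; congr (_ * _); apply: eq_bigr => i _.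
by rewrite expr_div_n -mulrA -invfM mulrC.
Qed.
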